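(* Let $O_1,\dots,O_n$ be i.i.d. from $P_0$, and let $\hat\Psi$ be an estimator of $\Psi(P_0)\in\mathbb{R}$ satisfying $$\hat\Psi-\Psi(P_0)=\frac1n\sum_{i=1}^n D^*(O_i)+R_{\mathrm{rem}},$$ where $D^*\in L^2_0(P_0)$, $\sigma^2_{\mathrm{EIF}}=\mathbb{E}_{P_0}[(D^* )^2]\in(0,\infty)$, $\|D^*\|_\infty\le M<\infty$ almost surely, $R_{\mathrm{rem}}=O_P(n^{-1/2})$, and $R_{\mathrm{rem}}=r_n\xi_n$ for a deterministic rate $r_n$ and $\xi_n=O_P(1)$. Then $$\mathrm{Var}\bigl(\hat\Psi-\Psi(P_0)\bigr)=\frac{\sigma^2_{\mathrm{EIF}}}{n}+\mathrm{Var}(R_{\mathrm{rem}})+2\,\mathrm{Cov}\Bigl(\frac1n\sum_{i=1}^n D^*(O_i),\,R_{\mathrm{rem}}\Bigr).$$ The sandwich variance estimator $\widehat{\mathrm{Var}}_{\mathrm{Sand}}(\hat\Psi)$ targets only the component $\sigma^2_{\mathrm{EIF}}/n$ and does not by itself account for $\mathrm{Var}(R_{\mathrm{rem}})$ or the covariance term.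
   Context: $\mathcal P$ is a nonparametric model, $\Psi:\mathcal P\to\mathbb R$ a pathwise differentiable functional with efficient influence function $D^*\in L^2_0(P_0)$ (mean-zero, square-integrable under $P_0$). $R_{\mathrm{rem}}=R_{\mathrm{rem}}(\hat P,P_0)$ is the second-order von Mises remainder, a random variable depending on the whole sample. The sandwich variance estimator $\widehat{\mathrm{Var}}_{\mathrm{Sand}}(\hat\Psi)$ is the usual influence-function-based estimator, built from the empirical second moment of the influence function divided by $n$; ''targets $\sigma^2_{\mathrm{EIF}}/n$'' means $n\,\widehat{\mathrm{Var}}_{\mathrm{Sand}}(\hat\Psi)\xrightarrow{P}\sigma^2_{\mathrm{EIF}}$. *)

(* Defs.v *)
From HB Require Import structures.
From mathcomp Require Import all_boot all_order all_algebra.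
From mathcomp Require Import finmap.
From mathcomp Require Import all_classical all_reals all_analysis.

Set Implicit Arguments.
Unset Strict Implicit.
Unset Printing Implicit Defensive.

Import Order.TTheory GRing.Theory Num.Theory.
Import numFieldNormedType.Exports.

Local Open Scope classical_set_scope.
Local Open Scope ring_scope.
Local Open Scope ereal_scope.

(** * Pathwise differentiability and efficient influence functions *)

Definition L2_0 (R : realType) (d : measure_display) (T : measurableType d)
    (P0 : probability T R) (g : T -> R) : Prop :=
  g \in Lfun P0 2%:E /\ 'E_P0[g] = 0.

(** [Q] is a path in the model [calP] through [P0] at [t = 0], dominated by a
    sigma-finite measure and differentiable in quadratic mean with score [g]. *)
Definition regular_submodel (R : realType) (d : measure_display)
    (T : measurableType d) (calP : set (probability T R))
    (P0 : probability T R) (Q : R -> probability T R) (g : T -> R) : Prop :=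
  [/\ Q 0%R = P0, (\forall t \near (0 : R)%R, calP (Q t)), L2_0 P0 g &
    exists (mu : {sigma_finite_measure set T -> \bar R}) (p : R -> T -> R),
      [/\ (forall t, measurable_fun [set: T] (p t)),
          (forall t x, (0 <= p t x)%R),
          (forall t A, measurable A -> Q t A = \int[mu]_(x in A) (p t x)%:E) &
          \int[mu]_x
            (((Num.sqrt (p t x) - Num.sqrt (p 0 x)) / t
              - 2^-1 * g x * Num.sqrt (p 0 x)) ^+ 2)%:E @[t --> (0 : R)%R^']
            --> (0 : \bar R)]].

Definition is_score (R : realType) (d : measure_display)
    (T : measurableType d) (calP : set (probability T R))
    (P0 : probability T R) (g : T -> R) : Prop :=
  exists Q, regular_submodel calP P0 Q g.

(** The tangent space: the closed linear span, in [L^2(P0)], of the scores. *)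
Definition tangent_space (R : realType) (d : measure_display)
    (T : measurableType d) (calP : set (probability T R))
    (P0 : probability T R) (h : T -> R) : Prop :=
  L2_0 P0 h /\
  forall e : R, (0 < e)%R ->
    exists (m : nat) (c : 'I_m -> R) (g : 'I_m -> T -> R),
      (forall i, is_score calP P0 (g i)) /\
      'E_P0[fun x => ((h x - \sum_(i < m) c i * g i x) ^+ 2)%R] < e%:E.

(** The model is (locally) nonparametric at [P0] when its tangent space is
    saturated, i.e. equal to [L^2_0(P0)]. *)
Definition nonparametric_at (R : realType) (d : measure_display)
    (T : measurableType d) (calP : set (probability T R))
    (P0 : probability T R) : Prop :=
  calP P0 /\ forall h, L2_0 P0 h -> tangent_space calP P0 h.

(** [D] is the canonical gradient of [Psi] at [P0]; in particular [Psi] is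
    pathwise differentiable at [P0]. Only the values of [Psi] on [calP] are
    constrained. *)
Definition is_EIF (R : realType) (d : measure_display)
    (T : measurableType d) (calP : set (probability T R))
    (Psi : probability T R -> R) (P0 : probability T R) (D : T -> R) : Prop :=
  tangent_space calP P0 D /\
  forall (Q : R -> probability T R) (g : T -> R),
    regular_submodel calP P0 Q g ->
    ((Psi (Q t) - Psi P0) / t)%R%:E @[t --> (0 : R)%R^']
      --> 'E_P0[fun x => (D x * g x)%R].

(** * Samples *)

Definition iid_from (R : realType) (d d' : measure_display)
    (T : measurableType d) (Omega : measurableType d')
    (P : probability Omega R) (P0 : probability T R)
    (O : nat -> {RV P >-> T}) : Prop :=
  (forall i A, measurable A -> P (O i @^-1` A) = P0 A) /\
  (forall (I : {fset nat}) (A : nat -> set T), (forall i, measurable (A i)) ->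
     P (\bigcap_(i in [set` I]) (O i @^-1` A i)) =
     \prod_(i <- I) P (O i @^-1` A i)).

Definition sample (R : realType) (d d' : measure_display)
    (T : measurableType d) (Omega : measurableType d')
    (P : probability Omega R) (O : nat -> {RV P >-> T}) (n : nat)
    (w : Omega) : n.-tuple T :=
  [tuple O i w | i < n].

Definition empirical_mean (R : realType) (d d' : measure_display)
    (T : measurableType d) (Omega : measurableType d')
    (P : probability Omega R) (O : nat -> {RV P >-> T}) (f : T -> R)
    (n : nat) (w : Omega) : R :=
  (n%:R^-1 * \sum_(i < n) f (O i w))%R.

Definition sandwich_variance (R : realType) (d d' : measure_display)
    (T : measurableType d) (Omega : measurableType d')
    (P : probability Omega R) (O : nat -> {RV P >-> T}) (D : T -> R)
    (n : nat) (w : Omega) : R :=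
  (empirical_mean O (fun x => D x ^+ 2) n w / n%:R)%R.

(** * Stochastic orders and convergence in probability *)

(** [X_n = O_P(a_n)] *)
Definition bigO_P (R : realType) (d : measure_display)
    (Omega : measurableType d) (P : probability Omega R)
    (X : nat -> Omega -> R) (a : nat -> R) : Prop :=
  forall e : R, (0 < e)%R ->
    exists2 C : R, (0 < C)%R &
      \forall n \near \oo, P [set w | (C * `|a n| < `|X n w|)%R] <= e%:E.

Definition cvg_in_prob (R : realType) (d : measure_display)
    (Omega : measurableType d) (P : probability Omega R)
    (X : nat -> Omega -> \bar R) (l : \bar R) : Prop :=
  forall e : R, (0 < e)%R ->
    P [set w | e%:E <= `| X n w - l |] @[n --> \oo] --> (0 : \bar R).

(** [V] estimates the variances [tau] on their [1/n] scale:
    [n (V_n - tau_n) -> 0] in probability. The target may be infinite, in which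
    case the distance to it is [+oo]. *)
Definition accounts_for (R : realType) (d : measure_display)
    (Omega : measurableType d) (P : probability Omega R)
    (V : nat -> Omega -> R) (tau : nat -> \bar R) : Prop :=
  cvg_in_prob P (fun n w => n%:R%:E * ((V n w)%:E - tau n)) 0.

(** * Estimators *)

(** The estimator [psihat] of [theta] is asymptotically linear with influence
    function [D], up to a remainder [Rrem = r_n xi_n = O_P(n^(-1/2))]. *)
Definition expansion_with_remainder (R : realType) (d d' : measure_display)
    (T : measurableType d) (Omega : measurableType d')
    (P : probability Omega R) (O : nat -> {RV P >-> T})
    (theta : R) (D : T -> R) (psihat : forall n, {mfun n.-tuple T >-> R})
    (Rrem : nat -> {RV P >-> R}) (r : nat -> R)
    (xi : nat -> {RV P >-> R}) : Prop :=
  [/\ (forall n w, (0 < n)%N ->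
         psihat n (sample O n w) - theta
         = empirical_mean O D n w + Rrem n w)%R,
      bigO_P P Rrem (fun n => (Num.sqrt n%:R)^-1)%R,
      (forall n w, (0 < n)%N -> Rrem n w = (r n * xi n w)%R) &
      bigO_P P xi (fun=> 1%R)].

Definition error (R : realType) (d d' : measure_display)
    (T : measurableType d) (Omega : measurableType d')
    (P : probability Omega R) (O : nat -> {RV P >-> T})
    (theta : R) (psihat : forall n, {mfun n.-tuple T >-> R})
    (n : nat) (w : Omega) : R :=
  (psihat n (sample O n w) - theta)%R.

(* Main.v *)
Require Import Defs.
From HB Require Import structures.
From mathcomp Require Import all_boot all_order all_algebra.
From mathcomp Require Import finmap.
From mathcomp Require Import all_classical all_reals all_analysis.
From mathcomp Require Import measurable_realfun.
From mathcomp Require Import ring.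

(** The linear term [S_n] is an average of bounded i.i.d. variables, so it has
    variance [sigma2 / n], and its covariance with an integrable remainder is
    finite; the decomposition then holds in [\bar R], both sides being [+oo]
    when the remainder is not square-integrable. Chebyshev's inequality applied
    to the average of the [Dstar (O_i) ^ 2] gives the limit of [n Vsand_n].
    Hence [n (Vsand_n - tau_n)] differs from
    [- n (tau_n - sigma2 / n)], which is deterministic, by a term that tends to
    [0] in probability, so [Vsand] accounts for [tau] exactly when
    [n (tau_n - sigma2 / n)] tends to [0]. Doubling the linear term gives the
    remainder [S_n], for which this fails. *)

Set Implicit Arguments.
Unset Strict Implicit.
Unset Printing Implicit Defensive.

Import Order.TTheory GRing.Theory Num.Theory.
Import numFieldNormedType.Exports.

Local Open Scope classical_set_scope.
Local Open Scope ring_scope.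
Local Open Scope ereal_scope.

(** * Convergence to 0 in the extended reals *)

(** Early terms may be infinite; the bound at 1 makes all later ones finite, and the claim reduces
    to real sequences. *)
Lemma cvge0_absP (R : realType) (u : nat -> \bar R) :
  u n @[n --> \oo] --> 0 <->
  forall e : R, (0 < e)%R -> \forall n \near \oo, `|u n| < e%:E.
Proof.
split=> [/cvg_abse|u0].
  rewrite abse0 => u0 e e0; apply: (u0 [set x | x < e%:E]).
  by apply: open_ereal_lt'; rewrite lte_fin.
apply/cvg_abse0P/fine_cvgP; split.
  have := u0 1%R ltr01; apply: filterS => n un /=.
  by rewrite ge0_fin_numE// (lt_trans un)// ltry.
apply/cvgrPdist_lt => e e0; have := u0 e e0; apply: filterS => n un /=.
rewrite sub0r normrN ger0_norm ?fine_ge0//.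
rewrite -lte_fin fineK// ge0_fin_numE//.
by rewrite (lt_trans un)// ltry.
Qed.

(** * Integrability and variance on a probability space *)

Section Lfun.
Context (R : realType) (d : measure_display) (T : measurableType d).
Variable P : probability T R.

Lemma Lfun_measurable p (f : T -> R) : f \in Lfun P p -> measurable_fun setT f.
Proof. by move=> /sub_Lfun_mfun; rewrite inE. Qed.

Lemma Lfun_subset21 (f : T -> R) : f \in Lfun P 2%:E -> f \in Lfun P 1.
Proof. by apply: Lfun_subset12; exact: fin_num_measure. Qed.

Lemma integrable_sqr_Lfun2 (f : T -> R) : measurable_fun setT f ->
  P.-integrable setT (EFin \o (fun x => f x ^+ 2)%R) -> f \in Lfun P 2%:E.
Proof.
move=> mf /integrableP[_ fi]; apply/andP; split; rewrite inE//=.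
rewrite /finite_norm unlock /Lnorm poweR_lty//.
apply: le_lt_trans fi; rewrite le_eqVlt; apply/orP; left; apply/eqP.
apply: eq_integral => x _ /=.
by rewrite powR_mulrn// normrX.
Qed.

Lemma ae_bounded_mul_Lfun1 (f g : T -> R) M : measurable_fun setT f ->
  {ae P, forall x, (`|f x| <= M)%R} -> g \in Lfun P 1 -> (f * g)%R \in Lfun P 1.
Proof.
move=> mf fM g1; have mg := Lfun_measurable g1.
move/Lfun1_integrable : g1 => gi.
apply/Lfun1_integrable/integrableP; split.
  by apply/measurable_EFinP; exact: measurable_funM.
have /integrableP[_] := integrableZl measurableT (`|M|)%R gi.
apply: le_lt_trans; apply: ae_ge0_le_integral => //.
- apply: measurableT_comp => //; apply/measurable_EFinP.
  exact: measurable_funM.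
- apply: measurableT_comp => //; apply: measurable_funeM.
  exact/measurable_EFinP.
- apply: filterS fM => x fx _ /=.
  by rewrite lee_fin !normrM normr_id ler_wpM2r// (le_trans fx)// ler_norm.
Qed.

Lemma ae_bounded_Lfun2 (f : T -> R) M :
  {ae P, forall x, (`|f x| <= M)%R} -> f \in Lfun P 1 -> f \in Lfun P 2%:E.
Proof.
move=> fM f1; have mf := Lfun_measurable f1.
apply: integrable_sqr_Lfun2 => //; apply/Lfun1_integrable.
exact: (ae_bounded_mul_Lfun1 mf fM f1).
Qed.

(** A finite variance puts [f - m], with [m] the mean, in L2; adding back the constant [m] would put
    [f] itself there. *)
Lemma variance_notin_Lfun2 (f : T -> R) :
  f \in Lfun P 1 -> f \notin Lfun P 2%:E -> 'V_P[f] = +oo.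
Proof.
move=> f1 f2; have mf := Lfun_measurable f1.
apply/eqP; rewrite -leye_eq leNgt; apply: contra f2 => Vf.
set m := fine 'E_P[f].
have fE : f = ((f \- cst m) + cst m)%R by apply/funext => x; rewrite /= subrK.
rewrite fE rpredD// ?lee1n// => [|?]; last exact: Lfun_cst.
have mfm : measurable_fun setT (f \- cst m)%R by exact: measurable_funB.
move=> ?; apply: integrable_sqr_Lfun2 => //; apply/integrableP; split.
  by apply/measurable_EFinP; exact: measurable_funX.
apply: le_lt_trans Vf; rewrite /variance 2!unlock.
rewrite le_eqVlt; apply/orP; left; apply/eqP; apply: eq_integral => x _.
by rewrite /= ger0_norm ?sqr_ge0// expr2 /m unlock.
Qed.

(* For [Y] integrable but not square-integrable both sides are [+oo]: the
   covariance is then still finite because [X] is bounded. *)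
Lemma varianceD_ae_bounded (X Y : T -> R) M :
  {ae P, forall x, (`|X x| <= M)%R} -> X \in Lfun P 1 -> Y \in Lfun P 1 ->
  'V_P[(X \+ Y)%R] = 'V_P[X] + 'V_P[Y] + 2%:E * covariance P X Y.
Proof.
move=> XM X1 Y1; have X2 := ae_bounded_Lfun2 XM X1.
have mX := Lfun_measurable X1; have XY1 := ae_bounded_mul_Lfun1 mX XM Y1.
have [Y2|Y2] := boolP (Y \in Lfun P 2%:E); first exact: varianceD.
have XY2 : (X \+ Y)%R \notin Lfun P 2%:E.
  apply: contra Y2 => XY2; have -> : Y = ((X \+ Y) - X)%R.
    by apply/funext => x; rewrite -[RHS]/(X x + Y x - X x)%R addrAC subrr add0r.
  by rewrite (@rpredB _ (Lfun P 2%:E) _ _ XY2 X2)// lee1n.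
rewrite [LHS]variance_notin_Lfun2//; last first.
  by rewrite (@rpredD _ (Lfun P 1) _ _ X1 Y1).
rewrite (variance_notin_Lfun2 Y1 Y2).
rewrite -(fineK (variance_fin_num X2)) -(fineK (covariance_fin_num X1 Y1 XY1)).
by rewrite -EFinM.
Qed.

End Lfun.

(** * Transfer of null sets, norms and expectations from the law [P0] to [X] *)

Section identically_distributed.
Context (R : realType) (d d' : measure_display) (T : measurableType d).
Context (Omega : measurableType d') (P : probability Omega R).
Context (P0 : probability T R) (X : {RV P >-> T}).
Hypothesis XP0 : forall A, measurable A -> P (X @^-1` A) = P0 A.

Lemma ae_comp_law (Q : T -> Prop) :
  {ae P0, forall x, Q x} -> {ae P, forall w, Q (X w)}.
Proof.
move=> [A [mA A0 QA]]; exists (X @^-1` A); split => //.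
- by rewrite -[_ @^-1` _]setTI; exact: measurable_funP.
- by rewrite XP0.
- by move=> w /= Qw; apply: QA.
Qed.

Lemma ge0_integral_law (f : T -> \bar R) : measurable_fun setT f ->
  (forall x, 0 <= f x) -> \int[P]_w f (X w) = \int[P0]_x f x.
Proof.
move=> mf f0; rewrite -(ge0_integral_distribution X mf f0).
by apply: eq_measure_integral => A mA _; exact: XP0.
Qed.

Lemma Lfun_comp_law (f : T -> R) (p : R) : (0 < p)%R ->
  f \in Lfun P0 p%:E -> f \o X \in Lfun P p%:E.
Proof.
move=> p0 f1; have mf := Lfun_measurable f1.
apply/andP; split; rewrite inE/=; first exact: measurableT_comp.
move: f1 => /sub_Lfun_finLfun; rewrite inE /finite_norm unlock /Lnorm/=.
rewrite -(@ge0_integral_law (fun x => (`|f x| `^ p)%:E))//.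
apply/measurable_EFinP.
by apply: (measurableT_comp (measurable_powR _)) => //; exact: measurableT_comp.
Qed.

Lemma expectation_comp_law (f : T -> R) :
  f \in Lfun P0 1 -> 'E_P[f \o X] = 'E_P0[f].
Proof.
move=> f1; have mf := Lfun_measurable f1.
have /Lfun1_integrable fX := Lfun_comp_law ltr01 f1.
rewrite unlock -(@integral_distribution _ _ _ _ _ _ X (EFin \o f))//.
  by apply: eq_measure_integral => A mA _; exact: XP0.
exact/measurable_EFinP.
Qed.

End identically_distributed.

(** * Independent variables are uncorrelated *)

Section independent.
Context (R : realType) (d d' : measure_display) (T : measurableType d).
Context (Omega : measurableType d') (P : probability Omega R).
Context (P0 : probability T R) (X Y : {RV P >-> T}).
Hypothesis XP0 : forall A, measurable A -> P (X @^-1` A) = P0 A.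
Hypothesis YP0 : forall A, measurable A -> P (Y @^-1` A) = P0 A.
Hypothesis indepXY : forall A B, measurable A -> measurable B ->
  P (X @^-1` A `&` Y @^-1` B) = P (X @^-1` A) * P (Y @^-1` B).

(** Independence makes the joint law of [(X, Y)] the product of [P0] with itself, and Fubini's
    theorem then factors the expectation of [f X * g Y]. *)
Lemma covariance_independent (f g : T -> R) :
  f \in Lfun P0 2%:E -> g \in Lfun P0 2%:E -> covariance P (f \o X) (g \o Y) = 0.
Proof.
move=> f2 g2.
have f1 := Lfun_subset21 f2; have g1 := Lfun_subset21 g2.
have mf := Lfun_measurable f1; have mg := Lfun_measurable g1.
have gt0_2 : (0 < 2 :> R)%R by [].
have fX2 := Lfun_comp_law XP0 gt0_2 f2; have gY2 := Lfun_comp_law YP0 gt0_2 g2.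
have fgXY1 := Lfun2_mul_Lfun1 fX2 gY2.
rewrite (covarianceE (Lfun_subset21 fX2) (Lfun_subset21 gY2) fgXY1).
rewrite (expectation_comp_law XP0 f1) (expectation_comp_law YP0 g1).
pose XY w := (X w, Y w).
have mXY : measurable_fun setT XY by exact: measurable_fun_pair.
pose Z : {RV P >-> (T * T)%type} := mfun_Sub (mem_set mXY).
(* A product measure is determined by its values on rectangles, where [indepXY] applies. *)
have lawZ A : measurable A -> (P0 \x P0) A = distribution P Z A.
  apply: product_measure_unique => B C mB mC.
  by have := indepXY mB mC; rewrite (XP0 mB) (YP0 mC).
pose F (z : T * T) := (f z.1 * g z.2)%:E.
have mF : measurable_fun setT F.
  apply/measurable_EFinP; apply: measurable_funM.
    exact: (measurableT_comp mf).
  exact: (measurableT_comp mg).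
have /Lfun1_integrable FZ := fgXY1.
(* Fubini for a signed integrand needs integrability; it is carried over from the product of two L2
   variables on the sample space. *)
have iF : (P0 \x P0).-integrable setT F.
  apply/integrableP; split => //.
  rewrite (@eq_measure_integral _ _ _ _ (distribution P Z)); last first.
    by move=> A mA _; exact: lawZ.
  rewrite (@ge0_integral_distribution _ _ _ _ _ _ Z (abse \o F))//.
  - by have /integrableP[] := FZ.
  - exact: measurableT_comp.
  - by move=> z; exact: abse_ge0.
rewrite [X in X - _](_ : _ = 'E_P0[f] * 'E_P0[g]).
  by rewrite subee// fin_numM ?expectation_fin_num.
transitivity (\int[P0 \x P0]_z F z).
  rewrite (@eq_measure_integral _ _ _ _ (distribution P Z)); last first.
    by move=> A mA _; exact: lawZ.
  by rewrite (@integral_distribution _ _ _ _ _ _ Z F)// unlock.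
rewrite -integral12_prod_meas1// /F.
have gE : (fun x => \int[P0]_y (f x * g y)%:E) = (fun x => (f x)%:E * 'E_P0[g]).
  apply/funext => x; under eq_integral do rewrite EFinM.
  by rewrite (integralZl measurableT ((Lfun1_integrable _ _).1 g1)) unlock.
rewrite /fubini_F gE.
rewrite -(fineK (expectation_fin_num g1)).
rewrite (integralZr measurableT ((Lfun1_integrable _ _).1 f1)).
by congr (_ * _); rewrite unlock.
Qed.

End independent.

(** * Moments of sums and averages of an i.i.d. sample, and the weak law *)

Section iid_sample.
Context (R : realType) (d d' : measure_display) (T : measurableType d).
Context (Omega : measurableType d') (P : probability Omega R).
Context (P0 : probability T R) (O : nat -> {RV P >-> T}).
Hypothesis iidO : iid_from P0 O.

Lemma iid_pair i j A B : i != j -> measurable A -> measurable B ->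
  P (O i @^-1` A `&` O j @^-1` B) = P (O i @^-1` A) * P (O j @^-1` B).
Proof.
move=> ij mA mB.
(* Mutual independence is applied to the index set of [i] and [j], with the family equal to [A] at
   [i] and to [B] elsewhere; [i != j] ensures that the product has two factors. *)
have mAB k : measurable (if k == i then A else B) by case: ifP.
have := iidO.2 (i |` [fset j])%fset _ mAB.
rewrite big_fsetU1 ?inE//= big_seq_fset1 eqxx eq_sym (negbTE ij) => <-.
congr (P _); apply/seteqP; split=> w /=.
  move=> [Aw Bw] k /=; rewrite !inE => /orP[] /eqP ->; first by rewrite eqxx.
  by rewrite eq_sym (negbTE ij).
move=> ABw; split.
  by have := ABw i; rewrite /= !inE eqxx; exact.
have := ABw j; rewrite /= !inE eqxx orbT eq_sym (negbTE ij); exact.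
Qed.

Lemma Lfun_sum_sample (p : R) (f : T -> R) n : (1 <= p)%R ->
  f \in Lfun P0 p%:E -> (fun w => \sum_(i < n) f (O i w))%R \in Lfun P p%:E.
Proof.
move=> p1 fp; have p0 : (0 < p)%R by rewrite (lt_le_trans ltr01).
elim: n => [|n IHn].
  under eq_fun do rewrite big_ord0.
  exact: Lfun_cst.
under eq_fun do rewrite big_ord_recr/=.
have fOn := Lfun_comp_law (iidO.1 n) p0 fp.
by apply: (@rpredD _ (Lfun P p%:E) _ _ IHn fOn); rewrite lee_fin.
Qed.

Lemma expectation_sum_sample (f : T -> R) n : f \in Lfun P0 1 ->
  'E_P[fun w => (\sum_(i < n) f (O i w))%R] = n%:R%:E * 'E_P0[f].
Proof.
move=> f1; elim: n => [|n IHn].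
  by under eq_fun do rewrite big_ord0; rewrite expectation_cst mul0e.
under eq_fun do rewrite big_ord_recr/=.
have fOn := Lfun_comp_law (iidO.1 n) ltr01 f1.
rewrite (expectationD (Lfun_sum_sample n (lexx 1%R) f1) fOn) IHn.
rewrite (expectation_comp_law (iidO.1 n) f1) -natr1 EFinD muleDl ?mul1e//.
exact: expectation_fin_num.
Qed.

(** By induction on [n]: the last term is uncorrelated with the sum of the earlier ones, so the
    variances add up. *)
Lemma variance_sum_sample (f : T -> R) n : f \in Lfun P0 2%:E ->
  'V_P[fun w => (\sum_(i < n) f (O i w))%R] = n%:R%:E * 'V_P0[f].
Proof.
move=> f2; have gt0_2 : (0 < 2 :> R)%R by [].
have ge1_2 : (1 <= 2 :> R)%R by rewrite ler1n.
have fO2 k : f \o O k \in Lfun P 2%:E := Lfun_comp_law (iidO.1 k) gt0_2 f2.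
have Vf k : 'V_P[f \o O k] = 'V_P0[f].
  rewrite !varianceE// (expectation_comp_law (iidO.1 k)) ?Lfun_subset21//.
  congr (_ - _).
  rewrite -(expectation_comp_law (iidO.1 k))//.
  exact: (Lfun2_mul_Lfun1 f2 f2).
(* The sum stops before index [m <= k], so every term in it has an index different from [k]. *)
have cov0 m k : (m <= k)%N ->
    covariance P (fun w => \sum_(i < m) f (O i w))%R (f \o O k) = 0.
  elim: m => [|m IHm] mk.
    by under eq_fun do rewrite big_ord0; rewrite covariance_cst_l.
  under eq_fun do rewrite big_ord_recr/=.
  rewrite (covarianceDl (Lfun_sum_sample m ge1_2 f2) (fO2 m) (fO2 k)).
  rewrite IHm 1?ltnW// add0e.
  apply: (covariance_independent (iidO.1 m) (iidO.1 k)) => // A B mA mB.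
  by apply: iid_pair => //; rewrite ltn_eqF.
elim: n => [|n IHn].
  by under eq_fun do rewrite big_ord0; rewrite variance_cst mul0e.
under eq_fun do rewrite big_ord_recr/=.
rewrite (varianceD (Lfun_sum_sample n ge1_2 f2) (fO2 n)) IHn.
rewrite cov0// mule0 adde0 [X in _ + X]Vf -natr1 EFinD muleDl ?mul1e//.
exact: variance_fin_num.
Qed.

Lemma empirical_meanE (f : T -> R) n :
  empirical_mean O f n = (n%:R^-1 \o* (fun w => \sum_(i < n) f (O i w)))%R.
Proof. by apply/funext => w; rewrite /empirical_mean/= mulrC. Qed.

Lemma Lfun2_empirical_mean (f : T -> R) n : f \in Lfun P0 2%:E ->
  empirical_mean O f n \in Lfun P 2%:E.
Proof.
move=> f2; rewrite empirical_meanE.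
by apply: Lfun_scale; [|apply: Lfun_sum_sample]; rewrite ?ler1n.
Qed.

Lemma variance_empirical_mean (f : T -> R) n : (0 < n)%N ->
  f \in Lfun P0 2%:E -> 'V_P[empirical_mean O f n] = n%:R^-1%:E * 'V_P0[f].
Proof.
move=> n0 f2; rewrite empirical_meanE varianceZ ?Lfun_sum_sample ?ler1n//.
rewrite variance_sum_sample// muleA -EFinM; congr (_%:E * _).
by rewrite expr2 -mulrA mulVf ?mulr1// pnatr_eq0 -lt0n.
Qed.

Lemma expectation_empirical_mean (f : T -> R) n : (0 < n)%N ->
  f \in Lfun P0 1 -> 'E_P[empirical_mean O f n] = 'E_P0[f].
Proof.
move=> n0 f1; rewrite empirical_meanE expectationZl; last exact: Lfun_sum_sample.
by rewrite expectation_sum_sample// muleA -EFinM mulVf ?mul1e// pnatr_eq0 -lt0n.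
Qed.

Lemma chebyshev_empirical_mean (f : T -> R) n (e : R) : (0 < n)%N -> (0 < e)%R ->
  f \in Lfun P0 2%:E ->
  P [set w | (e <= `|empirical_mean O f n w - fine 'E_P0[f]|)%R]
    <= ((e ^+ 2 * n%:R)^-1)%:E * 'V_P0[f].
Proof.
move=> n0 e0 f2; have mS := Lfun_measurable (Lfun2_empirical_mean n f2).
pose S : {RV P >-> R} := mfun_Sub (mem_set mS).
have := @chebyshev _ _ _ P S e e0.
rewrite [X in fine X](expectation_empirical_mean n0 (Lfun_subset21 f2)).
rewrite [X in _ * X](variance_empirical_mean n0 f2) => /le_trans; apply.
by rewrite muleA -EFinM -invfM.
Qed.

Lemma weak_lln (f : T -> R) : f \in Lfun P0 2%:E ->
  cvg_in_prob P (fun n w => (empirical_mean O f n w)%:E) 'E_P0[f].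
Proof.
move=> f2 e e0; rewrite -(fineK (expectation_fin_num (Lfun_subset21 f2))).
apply/cvge0_absP => eps eps0.
pose V := fine 'V_P0[f].
have V0 : (0 <= V)%R by rewrite fine_ge0// variance_ge0.
near=> n; have n0 : (0 < n)%N by near: n; exact: nbhs_infty_gt.
rewrite gee0_abs//; apply: (le_lt_trans (chebyshev_empirical_mean n0 e0 f2)).
rewrite -(fineK (variance_fin_num f2)) -EFinM lte_fin -/V.
(* Chebyshev's bound V / (e^2 n) drops below [eps] as soon as n exceeds V / (e^2 eps). *)
rewrite ltr_pdivrMl ?mulr_gt0 ?exprn_gt0 ?ltr0n//.
rewrite mulrAC -ltr_pdivrMl ?mulr_gt0 ?exprn_gt0//.
near: n; exact: nbhs_infty_gtr.
Unshelve. all: by end_near. Qed.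

End iid_sample.

(** * Random estimates against deterministic targets *)

Section convergence_in_probability.
Context (R : realType) (d : measure_display) (Omega : measurableType d).
Variable P : probability Omega R.

Lemma measurable_ge_abse (X : Omega -> \bar R) (e : R) :
  measurable_fun setT X -> measurable [set w | e%:E <= `|X w|].
Proof.
move=> mX; rewrite -[X in measurable X]setTI.
by apply: measurable_lee => //; exact: measurableT_comp.
Qed.

Lemma measurable_gt_normr (X : Omega -> R) (a : R) :
  measurable_fun setT X -> measurable [set w | (a < `|X w|)%R].
Proof.
move=> mX; rewrite -[X in measurable X]setTI.
under eq_set do rewrite -lte_fin.
apply: measurable_lte => //; apply/measurable_EFinP.
exact: measurableT_comp.
Qed.

Lemma near_eq_cvg_in_prob (X Y : nat -> Omega -> \bar R) l :
  (forall n, (0 < n)%N -> X n = Y n) -> cvg_in_prob P X l -> cvg_in_prob P Y l.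
Proof.
move=> XY Xl e e0; apply: cvg_trans (Xl e e0); apply: near_eq_cvg.
near=> n; have n0 : (0 < n)%N by near: n; exact: nbhs_infty_gt.
by rewrite XY.
Unshelve. all: by end_near. Qed.

(** The sequence [c] is deterministic: if n c_n is large at some n, it is large at every outcome,
    which convergence in probability forbids. Values of [c] may be infinite. *)
Lemma accounts_forP (V : nat -> Omega -> R) (tau c : nat -> \bar R) (s : R) :
  (forall n, measurable_fun setT (V n)) ->
  (forall n, (0 < n)%N -> tau n = (s / n%:R)%:E + c n) ->
  cvg_in_prob P (fun n w => (n%:R * V n w)%:E) s%:E ->
  accounts_for P V tau <-> n%:R%:E * c n @[n --> \oo] --> 0.
Proof.
move=> mV tauE Vs.
have XE n w : (0 < n)%N -> n%:R%:E * ((V n w)%:E - tau n) - 0 =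
    ((n%:R * V n w)%:E - s%:E) - n%:R%:E * c n.
  move=> n0; have n0R : (0 < n%:R :> R)%R by rewrite ltr0n.
  (* The regrouping survives an infinite [c n]: since n > 0 and the other terms are finite, both
     sides are then the infinity of sign opposite to that of [c n]. *)
  rewrite sube0 tauE//; case: (c n) => [r| |].
  - rewrite -!(EFinD, EFinB, EFinM); congr (_%:E).
    by field; rewrite gt_eqF.
  - by rewrite gt0_muley ?lte_fin//= gt0_muleNy ?lte_fin.
  - by rewrite gt0_muleNy ?lte_fin//= gt0_muley ?lte_fin.
have mX n : measurable_fun setT
    (fun w => n%:R%:E * ((V n w)%:E - tau n) - 0).
  apply: emeasurable_funB => //; apply: measurable_funeM.
  by apply: emeasurable_funB => //; exact/measurable_EFinP.
have mY n : measurable_fun setT (fun w => (n%:R * V n w)%:E - s%:E).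
  apply: emeasurable_funB => //; apply/measurable_EFinP.
  exact: measurable_funM.
split=> [Vtau|c0 e e0]; apply/cvge0_absP.
  move=> e e0; have e20 : (0 < e / 2)%R by rewrite divr_gt0.
  (* The level 1/2 is chosen so that two events, each of probability below it, cannot cover the
     whole space. *)
  have half0 : (0 < 2^-1 :> R)%R by rewrite invr_gt0.
  have /cvge0_absP/(_ _ half0) A0 := Vtau _ e20.
  have /cvge0_absP/(_ _ half0) B0 := Vs _ e20.
  near=> n; have n0 : (0 < n)%N by near: n; exact: nbhs_infty_gt.
  (* If n c_n had size at least [e], the triangle inequality would place every outcome in one of the
     two events with threshold [e / 2], giving the whole space probability below 1. *)
  rewrite ltNge; apply/negP => ec.
  have : P setT < 1.
    have PA : P [set w | (e / 2)%:E <= `|n%:R%:E * ((V n w)%:E - tau n) - 0|]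
        < 2^-1%:E by rewrite -[ltLHS]gee0_abs//; near: n.
    have PB : P [set w | (e / 2)%:E <= `|(n%:R * V n w)%:E - s%:E|]
        < 2^-1%:E by rewrite -[ltLHS]gee0_abs//; near: n.
    rewrite (_ : 1 = 2^-1%:E + 2^-1%:E); last by rewrite -EFinD -div1r -splitr.
    apply: le_lt_trans (lteD PA PB).
    apply: le_trans (measureU2 _ (measurable_ge_abse _ (mX n))
                                 (measurable_ge_abse _ (mY n))).
    apply: le_measure; rewrite ?inE//.
      by apply: measurableU; exact: measurable_ge_abse.
    move=> w _; apply: contrapT => /not_orP[/negP + /negP].
    rewrite -!ltNge XE// => Xw Yw.
    have := lteD Yw Xw; rewrite -(EFinD (e / 2)) -splitr; apply/negP; rewrite -leNgt.
    apply: le_trans ec _; rewrite -EFinB.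
    case: (n%:R%:E * c n) => [r| |] //=.
    by rewrite lee_fin -{1}(subKr (n%:R * V n w - s)%R r) ler_normB.
  by rewrite probability_setT ltxx.
move=> eps eps0; have e20 : (0 < e / 2)%R by rewrite divr_gt0.
have /cvge0_absP/(_ _ eps0) B0 := Vs _ e20.
have /cvge0_absP/(_ _ e20) {}c0 := c0.
near=> n; have n0 : (0 < n)%N by near: n; exact: nbhs_infty_gt.
have cn : `|n%:R%:E * c n| < (e / 2)%:E by near: n.
have Bn : P [set w | (e / 2)%:E <= `|(n%:R * V n w)%:E - s%:E|] < eps%:E.
  by rewrite -[ltLHS]gee0_abs//; near: n.
(* As n c_n has size below [e / 2], a deviation of at least [e] forces n V_n to be at least [e / 2]
   away from [s]. *)
rewrite gee0_abs//; apply: le_lt_trans Bn; apply: le_measure; rewrite ?inE.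
- exact: measurable_ge_abse.
- exact: measurable_ge_abse.
move=> w /=; rewrite XE// => eX; rewrite leNgt; apply/negP => Yw.
move: eX; apply/negP; rewrite -ltNge.
apply: le_lt_trans (lee_abs_sub _ _) _.
by rewrite [e]splitr EFinD lteD.
Unshelve. all: by end_near. Qed.

Lemma not_accounts_for (V : nat -> Omega -> R) (tau c : nat -> \bar R)
    (s k : R) :
  (forall n, measurable_fun setT (V n)) ->
  (forall n, (0 < n)%N -> tau n = (s / n%:R)%:E + c n) ->
  cvg_in_prob P (fun n w => (n%:R * V n w)%:E) s%:E ->
  (forall n, (0 < n)%N -> n%:R%:E * c n = k%:E) -> (0 < k)%R ->
  ~ accounts_for P V tau.
Proof.
move=> mV tauE Vs ck k0 /(accounts_forP mV tauE Vs)/cvge0_absP/(_ _ k0)[N _ ckN].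
(* The index is [N.+1] because the value [k] is known only at positive indices, and [N] may be 0. *)
have := ckN N.+1 (leqnSn N); rewrite /= ck//= gtr0_norm//.
by rewrite ltxx.
Qed.

End convergence_in_probability.

(** * The root-n rate of a centred average *)

Section bounded_in_probability.
Context (R : realType) (d d' : measure_display) (T : measurableType d).
Context (Omega : measurableType d') (P : probability Omega R).
Context (P0 : probability T R) (O : nat -> {RV P >-> T}).
Hypothesis iidO : iid_from P0 O.

Lemma bigO_P_empirical_mean (f : T -> R) : L2_0 P0 f ->
  bigO_P P (empirical_mean O f) (fun n => (Num.sqrt n%:R)^-1)%R.
Proof.
move=> [f2 Ef0] e e0; pose V := fine 'V_P0[f].
have V0 : (0 <= V)%R by rewrite fine_ge0// variance_ge0.
have V1 : (0 < V + 1)%R by rewrite ltr_wpDl.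
(* With this [C], Chebyshev's bound V / C^2 equals e V / (V + 1), which is at most [e]; the added 1
   keeps [C] positive when [V] is 0. *)
pose C := Num.sqrt ((V + 1) / e).
have C0 : (0 < C)%R by rewrite sqrtr_gt0 divr_gt0.
have C2 : (C ^+ 2 = (V + 1) / e)%R by rewrite sqr_sqrtr// divr_ge0// ltW.
exists C => //.
near=> n; have n0 : (0 < n)%N by near: n; exact: nbhs_infty_gt.
have sn0 : (0 < Num.sqrt n%:R :> R)%R by rewrite sqrtr_gt0 ltr0n.
have Cn0 : (0 < C / Num.sqrt n%:R)%R by rewrite divr_gt0.
have mS := Lfun_measurable (Lfun2_empirical_mean iidO n f2).
have := chebyshev_empirical_mean iidO n0 Cn0 f2.
rewrite Ef0 expr_div_n (sqr_sqrtr (ler0n R n)) divfK ?gt_eqF ?ltr0n//.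
rewrite C2 -(fineK (variance_fin_num f2)) -/V -EFinM.
rewrite invf_div => Pe.
apply: (@le_trans _ _ (e / (V + 1) * V)%:E); last first.
  by rewrite lee_fin mulrAC ler_pdivrMr// ler_pM2l// lerDl.
apply: le_trans Pe; apply: le_measure; rewrite ?inE.
- exact: measurable_gt_normr.
- under eq_set do rewrite subr0 -lee_fin -abse_EFin.
  by apply: measurable_ge_abse; exact/measurable_EFinP.
move=> w /=; rewrite subr0 ger0_norm ?invr_ge0 ?(ltW sn0)//.
exact: ltW.
Unshelve. all: by end_near. Qed.

End bounded_in_probability.

(** * The linear term, the sandwich estimator and the error variance *)

Section sandwich.
Context (R : realType) (d d' : measure_display) (T : measurableType d).
Context (Omega : measurableType d') (P : probability Omega R).
Context (P0 : probability T R) (D : T -> R) (O : nat -> {RV P >-> T}).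
Context (sigma2 M : R).
Hypothesis iidO : iid_from P0 O.
Hypothesis D_L2_0 : L2_0 P0 D.
Hypothesis D_sigma2 : 'E_P0[fun x => (D x ^+ 2)%R] = sigma2%:E.
Hypothesis D_bounded : {ae P0, forall x, (`|D x| <= M)%R}.

(** The bounds on the individual [D (O i)] hold simultaneously off a countable union of null sets,
    and averaging preserves them. *)
Lemma ae_bounded_empirical_mean n : (0 < n)%N ->
  {ae P, forall w, (`|empirical_mean O D n w| <= M)%R}.
Proof.
move=> n0.
have /ae_foralln : forall i, {ae P, forall w, (`|D (O i w)| <= M)%R}.
  by move=> i; exact: (ae_comp_law (iidO.1 i) D_bounded).
apply: filterS => w DM; rewrite normrM ger0_norm ?invr_ge0//.
rewrite ler_pdivrMl ?ltr0n//; apply: le_trans (ler_norm_sum _ _ _) _.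
apply: le_trans (ler_sum _ (fun (i : 'I_n) _ => DM i)) _.
by rewrite sumr_const card_ord mulr_natl.
Qed.

Lemma variance_influence : 'V_P0[D] = sigma2%:E.
Proof.
case: D_L2_0 => D2 D0; rewrite varianceE// D0 expe2 mul0e sube0.
by rewrite -D_sigma2.
Qed.

Lemma variance_linear_term n : (0 < n)%N ->
  'V_P[empirical_mean O D n] = (sigma2 / n%:R)%:E.
Proof.
move=> n0; rewrite (variance_empirical_mean iidO n0 D_L2_0.1).
by rewrite variance_influence -EFinM mulrC.
Qed.

(** Chebyshev's inequality for the average of the squares asks for a fourth moment of [D]; the
    almost sure bound supplies it. *)
Lemma sqr_influence_Lfun2 : (fun x => D x ^+ 2)%R \in Lfun P0 2%:E.
Proof.
have D2 := D_L2_0.1.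
have DD1 : (fun x => D x ^+ 2)%R \in Lfun P0 1.
  exact: (Lfun2_mul_Lfun1 D2 D2).
apply: (@ae_bounded_Lfun2 _ _ _ _ _ (M ^+ 2)%R) => //.
apply: filterS D_bounded => x Dx; rewrite normrX.
by rewrite lerXn2r// nnegrE// (le_trans _ Dx).
Qed.

Lemma measurable_sandwich_variance n :
  measurable_fun setT (sandwich_variance O D n).
Proof.
apply: measurable_funM => //.
exact: Lfun_measurable (Lfun2_empirical_mean iidO n sqr_influence_Lfun2).
Qed.

Lemma sandwich_varianceE n w : (0 < n)%N ->
  (n%:R * sandwich_variance O D n w = empirical_mean O (fun x => D x ^+ 2) n w)%R.
Proof. by move=> n0; rewrite mulrC divfK// pnatr_eq0 -lt0n. Qed.

Lemma sandwich_variance_cvg :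
  cvg_in_prob P (fun n w => (n%:R * sandwich_variance O D n w)%:E) sigma2%:E.
Proof.
rewrite -D_sigma2; apply: near_eq_cvg_in_prob (weak_lln iidO sqr_influence_Lfun2).
by move=> n n0; apply/funext => w; rewrite sandwich_varianceE.
Qed.

Lemma variance_errorE (theta : R) (psihat : forall n, {mfun n.-tuple T >-> R})
    (Rrem : nat -> {RV P >-> R}) (r : nat -> R) (xi : nat -> {RV P >-> R}) n :
  expansion_with_remainder O theta D psihat Rrem r xi ->
  (0 < n)%N -> (Rrem n : Omega -> R) \in Lfun P 1 ->
  'V_P[error O theta psihat n] = (sigma2 / n%:R)%:E + 'V_P[Rrem n]
    + 2%:E * covariance P (empirical_mean O D n) (Rrem n).
Proof.
move=> [psihatE _ _ _] n0 R1.
have -> : error O theta psihat n = (empirical_mean O D n \+ Rrem n)%R.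
  by apply/funext => w; rewrite /error psihatE.
rewrite (varianceD_ae_bounded (ae_bounded_empirical_mean n0) _ R1).
  by rewrite variance_linear_term.
exact: Lfun_subset21 (Lfun2_empirical_mean iidO n D_L2_0.1).
Qed.

(* Doubling the linear term makes the remainder equal to it, so that it has
   variance, and covariance with the linear term, [sigma2 / n]. *)
Lemma expansion_doubled_linear_term (theta : R) :
  exists (psihat : forall n, {mfun n.-tuple T >-> R})
         (Rrem : nat -> {RV P >-> R}) (r : nat -> R) (xi : nat -> {RV P >-> R}),
    expansion_with_remainder O theta D psihat Rrem r xi /\
    forall n, Rrem n = empirical_mean O D n :> (Omega -> R).
Proof.
have mD := Lfun_measurable D_L2_0.1.
have mS n := Lfun_measurable (Lfun2_empirical_mean iidO n D_L2_0.1).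
have mpsi n : measurable_fun setT (fun t : n.-tuple T =>
    theta + 2 * (n%:R^-1 * \sum_(i < n) D (tnth t i)))%R.
  apply: measurable_funD => //; apply: measurable_funM => //.
  apply: measurable_funM => //; apply: measurable_sum => i.
  by apply: (measurableT_comp mD); exact: measurable_tnth.
have mxi n : measurable_fun setT
    (fun w => Num.sqrt n%:R * empirical_mean O D n w)%R.
  exact: measurable_funM.
exists (fun n => mfun_Sub (mem_set (mpsi n))).
exists (fun n => mfun_Sub (mem_set (mS n))).
(* With rate n^(-1/2), the factor [xi] is the average scaled by the root of n; its boundedness in
   probability is that of the average at rate n^(-1/2), with the same [C]. *)
exists (fun n => (Num.sqrt n%:R)^-1)%R.
exists (fun n => mfun_Sub (mem_set (mxi n))); split => //.
have SO := bigO_P_empirical_mean iidO D_L2_0.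
split => [n w n0||n w n0|].
- rewrite /= addrAC subrr add0r mulr_natl mulr2n /empirical_mean.
  by under eq_bigr do rewrite tnth_mktuple.
- exact: SO.
- by rewrite /= mulKf// gt_eqF// sqrtr_gt0 ltr0n.
- move=> e e0; have [C C0 SC] := SO e e0; exists C => //.
  near=> n; have n0 : (0 < n)%N by near: n; exact: nbhs_infty_gt.
  have sn0 : (0 < Num.sqrt n%:R :> R)%R by rewrite sqrtr_gt0 ltr0n.
  have : P [set w | (C * `|(Num.sqrt n%:R)^-1| < `|empirical_mean O D n w|)%R]
    <= e%:E by near: n.
  apply: le_trans; rewrite le_eqVlt; apply/orP; left; apply/eqP; congr (P _).
  apply/eq_set => w; rewrite (normrM (Num.sqrt n%:R)) normr1 mulr1 normfV.
  by rewrite !(gtr0_norm sn0) ltr_pdivrMr// [in RHS]mulrC.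
Unshelve. all: by end_near. Qed.

End sandwich.

Theorem theorem3p1 (R : realType) (d d' : measure_display)
    (T : measurableType d) (Omega : measurableType d')
    (P : probability Omega R)
    (calP : set (probability T R)) (Psi : probability T R -> R)
    (P0 : probability T R) (Dstar : T -> R)
    (O : nat -> {RV P >-> T})
    (psihat : forall n, {mfun n.-tuple T >-> R})
    (Rrem : nat -> {RV P >-> R}) (r : nat -> R) (xi : nat -> {RV P >-> R})
    (sigma2 M : R)
    (nonparametricP : nonparametric_at calP P0)
    (eifD : is_EIF calP Psi P0 Dstar)
    (iidO : iid_from P0 O)
    (D_L2_0 : L2_0 P0 Dstar)
    (sigma2E : 'E_P0[fun x => (Dstar x ^+ 2)%R] = sigma2%:E)
    (sigma2_gt0 : (0 < sigma2)%R)
    (D_bounded : {ae P0, forall x, (`|Dstar x| <= M)%R})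
    (expansion : expansion_with_remainder O (Psi P0) Dstar psihat Rrem r xi) :
  let S := empirical_mean O Dstar in
  let Vsand := sandwich_variance O Dstar in
  [/\ (* the variance decomposition *)
      (forall n, (0 < n)%N -> (Rrem n : Omega -> R) \in Lfun P 1 ->
         'V_P[error O (Psi P0) psihat n] =
         (sigma2 / n%:R)%:E + 'V_P[Rrem n] + 2%:E * covariance P (S n) (Rrem n)),
      (* the sandwich estimator targets sigma2 / n *)
      cvg_in_prob P (fun n w => (n%:R * Vsand n w)%:E) sigma2%:E,
      (* it estimates the variance of the estimator exactly when the remaining
         terms, taken together, vanish on the 1/n scale *)
      ((forall n, (0 < n)%N -> (Rrem n : Omega -> R) \in Lfun P 1) ->
         accounts_for P Vsand (fun n => 'V_P[error O (Psi P0) psihat n]) <->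
         n%:R%:E * ('V_P[Rrem n] + 2%:E * covariance P (S n) (Rrem n))
           @[n --> \oo] --> (0 : \bar R)) &
      (* and the hypotheses on the remainder do not ensure this: for the same
         data, some estimator has both terms nonnegligible, and the sandwich
         estimator accounts for neither *)
      exists (psihat' : forall n, {mfun n.-tuple T >-> R})
             (Rrem' : nat -> {RV P >-> R}) (r' : nat -> R)
             (xi' : nat -> {RV P >-> R}),
        [/\ expansion_with_remainder O (Psi P0) Dstar psihat' Rrem' r' xi',
            (forall n, (Rrem' n : Omega -> R) \in Lfun P 2%:E),
            ~ accounts_for P Vsand
                (fun n => (sigma2 / n%:R)%:E + 'V_P[Rrem' n]),
            ~ accounts_for P Vsand
                (fun n => (sigma2 / n%:R)%:E
                          + 2%:E * covariance P (S n) (Rrem' n)) &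
            ~ accounts_for P Vsand
                (fun n => 'V_P[error O (Psi P0) psihat' n])]].
Proof.
move=> S Vsand.
have mV := measurable_sandwich_variance iidO D_L2_0 D_bounded.
have Vcvg := sandwich_variance_cvg iidO D_L2_0 sigma2E D_bounded.
have VE := variance_errorE iidO D_L2_0 sigma2E D_bounded.
split => //.
- by move=> n; exact: VE expansion.
- move=> R1; apply: (accounts_forP mV _ Vcvg) => n n0.
  by rewrite (VE _ _ _ _ _ _ expansion n0 (R1 n n0)) addeA.
have [psihat' [Rrem' [r' [xi' [expansion' RE]]]]] :=
  expansion_doubled_linear_term iidO D_L2_0 (Psi P0).
exists psihat', Rrem', r', xi'.
have R2 n : (Rrem' n : Omega -> R) \in Lfun P 2%:E.
  by rewrite RE; exact: (Lfun2_empirical_mean iidO n D_L2_0.1).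
have VR n : (0 < n)%N -> 'V_P[Rrem' n] = (sigma2 / n%:R)%:E.
  by move=> n0; rewrite RE (variance_linear_term iidO D_L2_0 sigma2E).
have covR n : (0 < n)%N -> covariance P (S n) (Rrem' n) = (sigma2 / n%:R)%:E.
  (* The remainder equals [S n], and the covariance of [S n] with itself is by definition its
     variance. *)
  by move=> n0; rewrite RE -(variance_linear_term iidO D_L2_0 sigma2E n0).
have n_neq0 n : (0 < n)%N -> (n%:R != 0 :> R)%R by rewrite pnatr_eq0 -lt0n.
split => //.
(* In the three refutations, the excess of the target over [sigma2 / n], multiplied by n, is a
   positive constant: [sigma2] from the remainder variance, [2 * sigma2] from the doubled
   covariance, and their sum [3 * sigma2] for the full error variance. *)
- apply: (not_accounts_for mV (fun n _ => erefl) Vcvg _ sigma2_gt0) => n n0.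
  by rewrite VR// -EFinM mulrC divfK ?n_neq0.
- have k0 : (0 < 2 * sigma2)%R by rewrite mulr_gt0.
  apply: (not_accounts_for mV (fun n _ => erefl) Vcvg _ k0) => n n0.
  by rewrite covR// -!EFinM mulrCA [(n%:R * _)%R]mulrC divfK ?n_neq0.
- have k0 : (0 < 3 * sigma2)%R by rewrite mulr_gt0.
  apply: (@not_accounts_for _ _ _ _ _ _
    (fun n => 'V_P[Rrem' n] + 2%:E * covariance P (S n) (Rrem' n)) _ _ mV _ Vcvg
    _ k0) => n n0.
    by rewrite addeA; exact: (VE _ _ _ _ _ _ expansion' n0 (Lfun_subset21 (R2 n))).
  rewrite VR// covR//.
  have -> : (3 * sigma2 = n%:R * (sigma2 / n%:R + 2 * (sigma2 / n%:R)))%R.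
    by field; exact: n_neq0.
  by rewrite EFinM EFinD EFinM.
Qed.
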